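(* Let $R$ be the set of the following eleven rewrite rules on binary trees, each tree being given by its prefix word (left member $\to$ right member): $2220000\to2020200$; $220202000\to220020200$; $20202202000\to20202020200$; $20220200200\to20202020200$; $2020220020200\to2020202022000$; $2022002020200\to2020202200200$; $2202200020200\to2200202020200$; $202020202200200\to202020202022000$; $202020220022000\to202020202020200$; $220020202200200\to220020202022000$; $220200202020200\to220020202022000$. Then the rewrite relation $\to_R$ induced by $R$ is convergent (terminating and confluent), and its reflexive, symmetric and transitive closure equals the congruence $\equiv_3$; that is, $R$ is a finite convergent presentation of $\mathbf{CAs}^{(3)}=\mathbf{Mag}/_{\equiv_3}$.
   Context: A binary tree is either the leaf or an ordered pair $(\mathfrak{t}_1,\mathfrak{t}_2)$ of binary trees. Its prefix word is defined by $\mathrm{p}(\text{leaf})=0$ and $\mathrm{p}((\mathfrak{t}_1,\mathfrak{t}_2))=2\,\mathrm{p}(\mathfrak{t}_1)\,\mathrm{p}(\mathfrak{t}_2)$; it determines the tree. $\mathbf{Mag}$ is the nonsymmetric set-theoretic operad of binary trees ($\mathbf{Mag}(n)$ = trees with $n$ leaves), with $\mathfrak{t}\circ_i\mathfrak{s}$ grafting the root of $\mathfrak{s}$ onto the $i$-th leaf (left to right) of $\mathfrak{t}$; $\mathfrak{s}\circ[\mathfrak{r}_1,\dots,\mathfrak{r}_n]$ grafts simultaneously each $\mathfrak{r}_j$ onto the $j$-th leaf of $\mathfrak{s}$. For a set $R$ of pairs $(\mathfrak{s},\mathfrak{s}')$ of trees of equal arity, the induced rewrite relation is $\mathfrak{t}\circ_i(\mathfrak{s}\circ[\mathfrak{r}_1,\dots,\mathfrak{r}_n])\to_R\mathfrak{t}\circ_i(\mathfrak{s}'\circ[\mathfrak{r}_1,\dots,\mathfrak{r}_n])$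 for all $(\mathfrak{s},\mathfrak{s}')\in R$ and all trees $\mathfrak{t},\mathfrak{r}_j$ and valid $i$ (i.e. replacing an occurrence of $\mathfrak{s}$ anywhere in a tree by $\mathfrak{s}'$). It is terminating if there is no infinite chain $\mathfrak{t}_0\to_R\mathfrak{t}_1\to_R\cdots$, and confluent if whenever $\mathfrak{t}\to_R^*\mathfrak{s}_1$ and $\mathfrak{t}\to_R^*\mathfrak{s}_2$ there is $\mathfrak{t}'$ with $\mathfrak{s}_1\to_R^*\mathfrak{t}'$ and $\mathfrak{s}_2\to_R^*\mathfrak{t}'$ ($\to_R^*$ the reflexive-transitive closure). Combs: $\mathrm{LComb}_1=\mathrm{RComb}_1=(\text{leaf},\text{leaf})$, $\mathrm{LComb}_d=(\mathrm{LComb}_{d-1},\text{leaf})$, $\mathrm{RComb}_d=(\text{leaf},\mathrm{RComb}_{d-1})$. $\equiv_3$ is the smallest operad congruence on $\mathbf{Mag}$ (arity-preserving equivalence relation compatible with all partial compositions) with $\mathrm{LComb}_3\equiv_3\mathrm{RComb}_3$. *)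

(* Defs.v *)
From Stdlib Require Export Relation_Definitions Relation_Operators.
From mathcomp Require Export all_boot.

Set Implicit Arguments.
Unset Strict Implicit.
Unset Printing Implicit Defensive.

Inductive tree : Type := Leaf | Node (l r : tree).

Fixpoint arity (t : tree) : nat :=
  if t is Node l r then arity l + arity r else 1.

Fixpoint prefix_word (t : tree) : seq nat :=
  if t is Node l r then 2 :: prefix_word l ++ prefix_word r else [:: 0].

(* The partial composition t o_i s, leaves being numbered from 1; it is only
   meaningful for 1 <= i <= arity t. *)
Fixpoint graft (t : tree) (i : nat) (s : tree) : tree :=
  if t is Node l r then
    if i <= arity l then Node (graft l i s) r
    else Node l (graft r (i - arity l) s)
  else s.

(* The complete composition s o [r_1, ..., r_n]; it is only meaningful for
   size rs = arity s. *)
Fixpoint graft_all (s : tree) (rs : seq tree) : tree :=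
  if s is Node l r then
    Node (graft_all l (take (arity l) rs)) (graft_all r (drop (arity l) rs))
  else head Leaf rs.

Inductive rewrite_step (R : relation tree) : relation tree :=
  RewriteStep (t : tree) (i : nat) (s s' : tree) (rs : seq tree) :
    0 < i <= arity t -> size rs = arity s -> R s s' ->
    rewrite_step R (graft t i (graft_all s rs)) (graft t i (graft_all s' rs)).

Definition terminating (T : Type) (step : relation T) : Prop :=
  ~ exists u : nat -> T, forall k, step (u k) (u k.+1).

Definition confluent (T : Type) (step : relation T) : Prop :=
  forall t s1 s2 : T,
    clos_refl_trans T step t s1 -> clos_refl_trans T step t s2 ->
    exists2 t', clos_refl_trans T step s1 t' & clos_refl_trans T step s2 t'.

Definition convergent (T : Type) (step : relation T) : Prop :=
  terminating step /\ confluent step.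

Record operad_congruence (E : relation tree) : Prop := OperadCongruence {
  congr_equiv : equivalence tree E;
  congr_arity : forall t t', E t t' -> arity t = arity t';
  congr_graft : forall t t' s s' i, 0 < i <= arity t ->
    E t t' -> E s s' -> E (graft t i s) (graft t' i s')
}.

(* LComb_d and RComb_d for d >= 1, extended by the leaf at d = 0. *)
Fixpoint LComb (d : nat) : tree :=
  if d is d'.+1 then Node (LComb d') Leaf else Leaf.

Fixpoint RComb (d : nat) : tree :=
  if d is d'.+1 then Node Leaf (RComb d') else Leaf.

(* The smallest operad congruence relating LComb_d and RComb_d, as the
   intersection of all of them. *)
Definition comb_congruence (d : nat) : relation tree := fun t t' =>
  forall E : relation tree,
    operad_congruence E -> E (LComb d) (RComb d) -> E t t'.

Definition CAs3_rule_words : seq (seq nat * seq nat) :=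
  [:: ([:: 2; 2; 2; 0; 0; 0; 0],
       [:: 2; 0; 2; 0; 2; 0; 0]);
      ([:: 2; 2; 0; 2; 0; 2; 0; 0; 0],
       [:: 2; 2; 0; 0; 2; 0; 2; 0; 0]);
      ([:: 2; 0; 2; 0; 2; 2; 0; 2; 0; 0; 0],
       [:: 2; 0; 2; 0; 2; 0; 2; 0; 2; 0; 0]);
      ([:: 2; 0; 2; 2; 0; 2; 0; 0; 2; 0; 0],
       [:: 2; 0; 2; 0; 2; 0; 2; 0; 2; 0; 0]);
      ([:: 2; 0; 2; 0; 2; 2; 0; 0; 2; 0; 2; 0; 0],
       [:: 2; 0; 2; 0; 2; 0; 2; 0; 2; 2; 0; 0; 0]);
      ([:: 2; 0; 2; 2; 0; 0; 2; 0; 2; 0; 2; 0; 0],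
       [:: 2; 0; 2; 0; 2; 0; 2; 2; 0; 0; 2; 0; 0]);
      ([:: 2; 2; 0; 2; 2; 0; 0; 0; 2; 0; 2; 0; 0],
       [:: 2; 2; 0; 0; 2; 0; 2; 0; 2; 0; 2; 0; 0]);
      ([:: 2; 0; 2; 0; 2; 0; 2; 0; 2; 2; 0; 0; 2; 0; 0],
       [:: 2; 0; 2; 0; 2; 0; 2; 0; 2; 0; 2; 2; 0; 0; 0]);
      ([:: 2; 0; 2; 0; 2; 0; 2; 2; 0; 0; 2; 2; 0; 0; 0],
       [:: 2; 0; 2; 0; 2; 0; 2; 0; 2; 0; 2; 0; 2; 0; 0]);
      ([:: 2; 2; 0; 0; 2; 0; 2; 0; 2; 2; 0; 0; 2; 0; 0],
       [:: 2; 2; 0; 0; 2; 0; 2; 0; 2; 0; 2; 2; 0; 0; 0]);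
      ([:: 2; 2; 0; 2; 0; 0; 2; 0; 2; 0; 2; 0; 2; 0; 0],
       [:: 2; 2; 0; 0; 2; 0; 2; 0; 2; 0; 2; 2; 0; 0; 0])].

Definition CAs3_rule : relation tree := fun s s' =>
  (prefix_word s, prefix_word s') \in CAs3_rule_words.

Lemma prefix_word_inj : injective prefix_word.
Proof.
have cat_inj t : forall t' w w',
    prefix_word t ++ w = prefix_word t' ++ w' -> t = t' /\ w = w'.
  elim: t => [|l IHl r IHr] [|l' r'] w w' //=; first by case.
  by case; rewrite -!catA => /IHl [-> /IHr [-> ->]].
by move=> t t' e; have [] := cat_inj t t' [::] [::]; rewrite ?e.
Qed.

(* No rule is lost by reading the trees off their prefix words, and both
   members of each rule have the same arity. *)
Lemma CAs3_rule_wordsP w :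
  w \in CAs3_rule_words ->
  exists s s', w = (prefix_word s, prefix_word s') /\ arity s = arity s'.
Proof.
pose parse := fix parse (w : seq nat) : seq tree :=
  match w with
  | [::] => [::]
  | a :: w' =>
      if a == 0 then Leaf :: parse w'
      else if parse w' is l :: r :: ts then Node l r :: ts else [::]
  end.
pose tr w := head Leaf (parse w).
move=> w_rule; exists (tr w.1), (tr w.2).
have all_ok : all
    (fun w => (w == (prefix_word (tr w.1), prefix_word (tr w.2)))
              && (arity (tr w.1) == arity (tr w.2))) CAs3_rule_words.
  by vm_compute.
by have /andP[/eqP ? /eqP ?] := allP all_ok w w_rule.
Qed.

(* Main.v *)
(* Termination: each rule decreases the prefix word lexicographically, and this
   survives substitution because the first difference between the two words
   faces a leaf with a node.
   Confluence: by Newman's lemma it is enough to join local peaks.  Left members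
   are linear, so the only peaks that do not commute are instances of overlaps of
   one left member with an internal node of another; there are finitely many of
   them (693), and both reducts of each have the same normal form, by computation.
   Congruence: every rule is a consequence of LComb_3 = RComb_3, which a
   breadth-first search confirms, and this equation is the first rule. *)

From HB Require Import structures.
From Stdlib Require Import Operators_Properties.
From mathcomp Require Import zify.
Require Import Defs.

Set Implicit Arguments.
Unset Strict Implicit.
Unset Printing Implicit Defensive.

HB.instance Definition _ := Equality.copy tree (inj_type prefix_word_inj).

(** * Complete composition and its associativity *)

Lemma arity_gt0 t : 0 < arity t.
Proof. by elim: t => //= l IHl r _; rewrite addn_gt0 IHl. Qed.

Lemma graft_all_take s rs : graft_all s (take (arity s) rs) = graft_all s rs.
Proof.
elim: s rs => [|l IHl r IHr] rs /=; first by case: rs.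
by rewrite take_takel ?leq_addr // addnC -take_drop IHr.
Qed.

(** Surplus trees at the end of [rs] are never read, so the left factor may be given the whole
    list. *)
Lemma graft_all_Node l r rs :
  graft_all (Node l r) rs = Node (graft_all l rs) (graft_all r (drop (arity l) rs)).
Proof. by rewrite /= graft_all_take. Qed.

Lemma graft_all_cat s rs rs' :
  arity s <= size rs -> graft_all s (rs ++ rs') = graft_all s rs.
Proof. by move=> ?; rewrite -graft_all_take takel_cat // graft_all_take. Qed.

Lemma graft_all_Node_cat l r rs rs' : size rs = arity l ->
  graft_all (Node l r) (rs ++ rs') = Node (graft_all l rs) (graft_all r rs').
Proof.
by move=> size_rs; rewrite graft_all_Node graft_all_cat ?size_rs // -size_rs
                           drop_size_cat.
Qed.

Lemma graft_all_Leaf t rs : {in rs, forall r, r = Leaf} -> graft_all t rs = t.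
Proof.
elim: t rs => [|l IHl r IHr] rs rsP.
  by case: rs rsP => //= r rs; apply; apply: mem_head.
by rewrite graft_all_Node IHl // IHr // => x /mem_drop/rsP.
Qed.

Lemma size_split (T : Type) (s : seq T) m n : size s = m + n ->
  exists s1 s2, [/\ s = s1 ++ s2, size s1 = m & size s2 = n].
Proof.
move=> size_s; exists (take m s), (drop m s).
rewrite cat_take_drop size_take_min size_drop size_s addKn.
by split=> //; apply/minn_idPl/leq_addr.
Qed.

Lemma arity_graft_all s rs : size rs = arity s ->
  arity (graft_all s rs) = sumn (map arity rs).
Proof.
elim: s rs => [|l IHl r IHr] rs; first by case: rs => [|a []] //= _; rewrite addn0.
move=> /size_split[rs1 [rs2 [-> size1 size2]]].
by rewrite graft_all_Node_cat //= IHl // IHr // map_cat sumn_cat.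
Qed.

(** The inner composites in the associativity of complete composition: each tree of [rs] takes from
    [qs] a block as long as its arity. *)
Fixpoint graft_blocks (rs qs : seq tree) : seq tree :=
  if rs is r :: rs' then graft_all r qs :: graft_blocks rs' (drop (arity r) qs)
  else [::].

Lemma size_graft_blocks rs qs : size (graft_blocks rs qs) = size rs.
Proof. by elim: rs qs => //= r rs IH qs; rewrite IH. Qed.

Lemma graft_blocks_cat rs1 rs2 qs :
  graft_blocks (rs1 ++ rs2) qs =
  graft_blocks rs1 qs ++ graft_blocks rs2 (drop (sumn (map arity rs1)) qs).
Proof.
elim: rs1 qs => [|r rs IH] qs /=; first by rewrite drop0.
by rewrite IH drop_drop addnC.
Qed.

Lemma graft_allA s rs qs : size rs = arity s ->
  graft_all (graft_all s rs) qs = graft_all s (graft_blocks rs qs).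
Proof.
elim: s rs qs => [|l IHl r IHr] rs qs; first by case: rs => [|a []].
move=> /size_split[rs1 [rs2 [-> size1 size2]]].
rewrite graft_all_Node_cat // graft_all_Node IHl // IHr // graft_blocks_cat.
by rewrite graft_all_Node_cat ?size_graft_blocks // arity_graft_all.
Qed.

(** * Matching and superposition of trees *)

(** Leaves of [s] act as distinct variables: this is matching at the root, and [cut] returns the
    matching substitution. *)
Fixpoint tprefix (s t : tree) : bool :=
  match s, t with
  | Leaf, _ => true
  | Node l r, Node t1 t2 => tprefix l t1 && tprefix r t2
  | _, _ => false
  end.

Fixpoint cut (s t : tree) : seq tree :=
  match s, t with
  | Leaf, _ => [:: t]
  | Node l r, Node t1 t2 => cut l t1 ++ cut r t2
  | _, _ => [::]
  end.

(** The most general common instance: with leaves as distinct variables, two patterns always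
    unify. *)
Fixpoint tjoin (s t : tree) : tree :=
  match s, t with
  | Leaf, _ => t
  | _, Leaf => s
  | Node l r, Node t1 t2 => Node (tjoin l t1) (tjoin r t2)
  end.

Lemma tprefix_trans : transitive tprefix.
Proof.
move=> y x z; elim: x y z => [|l IHl r IHr] // [//|y1 y2] [//|z1 z2] /=.
by case/andP=> ly1 ry2 /andP[yz1 yz2]; rewrite (IHl y1) // (IHr y2).
Qed.

Lemma tprefix_graft_all s rs : tprefix s (graft_all s rs).
Proof. by elim: s rs => //= l IHl r IHr rs; rewrite IHl IHr. Qed.

Lemma cut_graft_all s rs : size rs = arity s -> cut s (graft_all s rs) = rs.
Proof.
elim: s rs => [|l IHl r IHr] rs; first by case: rs => [|a []].
move=> /size_split[rs1 [rs2 [-> size1 size2]]].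
by rewrite graft_all_Node_cat //= IHl // IHr.
Qed.

Lemma size_cut s t : tprefix s t -> size (cut s t) = arity s.
Proof.
elim: s t => [|l IHl r IHr] [|t1 t2] //= /andP[lt1 rt2].
by rewrite size_cat IHl // IHr.
Qed.

Lemma graft_all_cut s t : tprefix s t -> graft_all s (cut s t) = t.
Proof.
elim: s t => [|l IHl r IHr] [|t1 t2] // /andP[lt1 rt2].
by rewrite [cut _ _]/= graft_all_Node_cat ?size_cut // IHl // IHr.
Qed.

Lemma tprefixxx : reflexive tprefix.
Proof. by elim=> //= l -> r ->. Qed.

Lemma tprefix_tjoinl s t : tprefix s (tjoin s t).
Proof.
elim: s t => //= l IHl r IHr [|t1 t2] /=; first by rewrite !tprefixxx.
by rewrite IHl IHr.
Qed.

Lemma tprefix_tjoinr s t : tprefix t (tjoin s t).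
Proof.
elim: t s => //= l IHl r IHr [|s1 s2] /=; first by rewrite !tprefixxx.
by rewrite IHl IHr.
Qed.

Lemma tprefix_tjoin s s' t : tprefix s t -> tprefix s' t -> tprefix (tjoin s s') t.
Proof.
elim: t s s' => [|t1 IH1 t2 IH2] [|l r] [|l' r'] //= /andP[? ?] /andP[? ?].
by rewrite IH1 // IH2.
Qed.

Definition contract (rho : tree * tree) (t : tree) : tree :=
  graft_all rho.2 (cut rho.1 t).

(** * One-step reductions and overlaps *)

(** Positions are paths from the root, which suits induction; [rewrite_stepP] relates this to
    numbered leaves. *)
Inductive step (R : seq (tree * tree)) : relation tree :=
  | StepRoot rho t : rho \in R -> tprefix rho.1 t -> step R t (contract rho t)
  | StepLeft l l' r : step R l l' -> step R (Node l r) (Node l' r)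
  | StepRight l r r' : step R r r' -> step R (Node l r) (Node l r').

Fixpoint reducts (R : seq (tree * tree)) (t : tree) : seq tree :=
  [seq contract rho t | rho <- R & tprefix rho.1 t] ++
  if t is Node l r then
    [seq Node l' r | l' <- reducts R l] ++ [seq Node l r' | r' <- reducts R r]
  else [::].

Lemma reducts_step R t u : u \in reducts R t -> step R t u.
Proof.
have root t' u' : u' \in [seq contract rho t' | rho <- R & tprefix rho.1 t'] ->
    step R t' u'.
  by case/mapP=> rho; rewrite mem_filter => /andP[? ?] ->; apply: StepRoot.
elim: t u => [|l IHl r IHr] u; rewrite /= mem_cat => /orP[/root|] //.
rewrite mem_cat => /orP[] /mapP[v + ->].
  by move/IHl/StepLeft.
by move/IHr/StepRight.
Qed.

(** Leftmost-outermost reduction; the default of [head] keeps normal forms fixed, so [n] need only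
    bound the number of steps. *)
Definition normalize R n t := iter n (fun t' => head t' (reducts R t')) t.

Lemma normalize_steps R n t : clos_refl_trans tree (step R) t (normalize R n t).
Proof.
elim: n => [|n IH] /=; first exact: rt_refl.
apply: rt_trans IH _; case E: (reducts R _) => [|u us] /=; first exact: rt_refl.
by apply/rt_step/reducts_step; rewrite E mem_head.
Qed.

(* The pairs consist of the merge of [s] with the left member of a rule placed at
   an internal node of [s], and of its reduct by that rule; the reduct by a rule
   with left member [s] is left to the caller. *)
Fixpoint overlaps (R : seq (tree * tree)) (s : tree) : seq (tree * tree) :=
  if s is Node l r then
    [seq (tjoin s rho.1, contract rho (tjoin s rho.1)) | rho <- R] ++
    [seq (Node mu.1 r, Node mu.2 r) | mu <- overlaps R l] ++
    [seq (Node l mu.1, Node l mu.2) | mu <- overlaps R r]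
  else [::].

Lemma overlaps_step R s mu : mu \in overlaps R s ->
  tprefix s mu.1 /\ step R mu.1 mu.2.
Proof.
elim: s mu => // l IHl r IHr mu; rewrite [overlaps _ _]/= !mem_cat.
case/or3P=> /mapP[nu nuP ->].
- split; first exact: (tprefix_tjoinl (Node l r)).
  exact/StepRoot/(tprefix_tjoinr (Node l r)).
- have [? ?] := IHl _ nuP; split; last exact: StepLeft.
  by apply/andP; split=> //; apply: tprefixxx.
have [? ?] := IHr _ nuP; split; last exact: StepRight.
by apply/andP; split=> //; apply: tprefixxx.
Qed.

Inductive seq_step (R : seq (tree * tree)) : relation (seq tree) :=
  | SeqStepHead t u ts : step R t u -> seq_step R (t :: ts) (u :: ts)
  | SeqStepTail t ts us : seq_step R ts us -> seq_step R (t :: ts) (t :: us).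

Lemma seq_step_size R ts us : seq_step R ts us -> size ts = size us.
Proof. by elim=> //= ? ? ? _ ->. Qed.

Lemma seq_step_catl R ts us vs :
  seq_step R ts us -> seq_step R (ts ++ vs) (us ++ vs).
Proof.
by elim=> *; [apply: SeqStepHead | apply: SeqStepTail].
Qed.

Lemma seq_step_catr R ts us vs :
  seq_step R ts us -> seq_step R (vs ++ ts) (vs ++ us).
Proof. by move=> ?; elim: vs => //= v vs; apply: SeqStepTail. Qed.

Lemma seq_step_cat_inv R ts1 ts2 us : seq_step R (ts1 ++ ts2) us ->
  (exists2 us1, us = us1 ++ ts2 & seq_step R ts1 us1) \/
  (exists2 us2, us = ts1 ++ us2 & seq_step R ts2 us2).
Proof.
elim: ts1 us => [|t ts1 IH] us /=; first by right; exists us.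
move E: (t :: _) => ts tsP; case: ts us / tsP E => [t0 u ts tu | t0 ts us tsP].
  by case=> -> <-; left; exists (u :: ts1) => //; apply: SeqStepHead.
case=> -> Ets; rewrite -{}Ets in tsP; case: (IH _ tsP) => -[vs -> vsP].
  by left; exists (t0 :: vs) => //; apply: SeqStepTail.
by right; exists vs.
Qed.

(** Each leaf of [s] receives exactly one tree, so a step inside the substitution is a single step
    of the composite. *)
Lemma seq_step_graft_all R s ts us : size ts = arity s -> seq_step R ts us ->
  step R (graft_all s ts) (graft_all s us).
Proof.
elim: s ts us => [|l IHl r IHr] ts us.
  case: ts => // t [] // _ tsP; inversion tsP as [? ? ? tu|? ? ? nilP]; subst=> //.
  by inversion nilP.
move=> /size_split[ts1 [ts2 [-> size1 size2]]] /seq_step_cat_inv[] [vs -> vsP].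
  rewrite !graft_all_Node_cat -?(seq_step_size vsP) //.
  exact/StepLeft/IHl.
by rewrite !graft_all_Node_cat //; apply/StepRight/IHr.
Qed.

(** * Local confluence from the joinability of overlaps *)

Section ArityPreserving.

Variable R : seq (tree * tree).
Hypothesis arityR : {in R, forall rho, arity rho.1 = arity rho.2}.

Lemma arity_contract rho t : rho \in R -> tprefix rho.1 t ->
  arity (contract rho t) = arity t.
Proof.
move=> rhoR rho_t; rewrite -[in RHS](graft_all_cut rho_t).
by rewrite !arity_graft_all ?size_cut -?arityR.
Qed.

Lemma step_arity t u : step R t u -> arity t = arity u.
Proof.
by elim=> [rho {}t ? ?|l l' r _ /= ->|l r r' _ /= ->] //; rewrite arity_contract.
Qed.

(** Associativity pushes [qs] into the matching substitution, which contraction carries over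
    unchanged. *)
Lemma contract_graft_all rho t qs : rho \in R -> tprefix rho.1 t ->
  contract rho (graft_all t qs) = graft_all (contract rho t) qs.
Proof.
move=> rhoR rho_t; rewrite /contract -[in LHS](graft_all_cut rho_t).
rewrite !graft_allA ?size_cut ?arityR // cut_graft_all ?size_graft_blocks //.
by rewrite size_cut.
Qed.

Lemma step_subst t u qs : step R t u -> step R (graft_all t qs) (graft_all u qs).
Proof.
move=> tu; elim: tu qs => [rho {}t rhoR rho_t|l l' r ll' IH|l r r' rr' IH] qs.
- rewrite -contract_graft_all //; apply: StepRoot => //.
  exact: tprefix_trans rho_t (tprefix_graft_all _ _).
- by rewrite !graft_all_Node (step_arity ll'); apply: StepLeft.
by rewrite !graft_all_Node; apply: StepRight.
Qed.

(** Critical pair analysis: the redex lies either inside the substitution or at an internal node of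
    [s], where it is an instance of an overlap. *)
Lemma step_prefixP s t u : tprefix s t -> step R t u ->
  (exists2 us, seq_step R (cut s t) us & u = graft_all s us) \/
  (exists2 mu, mu \in overlaps R s &
     exists qs, [/\ size qs = arity mu.1, t = graft_all mu.1 qs
                  & u = graft_all mu.2 qs]).
Proof.
move=> + tu; elim: t u / tu s => [rho t rhoR rho_t|t1 u t2 tu IH|t1 t2 u tu IH].
- case=> [_|l r s_t].
    by left; exists [:: contract rho t] => //; apply/SeqStepHead/StepRoot.
  (* [t] is an instance of both [s] and [rho.1], hence of their join. *)
  right; set s := Node l r in s_t *; set m := tjoin s rho.1.
  exists (m, contract rho m).
    by rewrite /= mem_cat; apply/orP; left; apply/mapP; exists rho.
  have m_t : tprefix m t by apply: tprefix_tjoin.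
  exists (cut m t); rewrite size_cut //= graft_all_cut //; split=> //.
  by rewrite -contract_graft_all ?graft_all_cut // tprefix_tjoinr.
- case=> [_|l r /andP[lt1 rt2]].
    by left; exists [:: Node u t2] => //; apply/SeqStepHead/StepLeft.
  case: (IH _ lt1) => [[us usP ->]|[mu muP [qs [size_qs -> ->]]]].
    left; exists (us ++ cut r t2); first exact: seq_step_catl.
    by rewrite graft_all_Node_cat ?graft_all_cut // -(seq_step_size usP) size_cut.
  right; exists (Node mu.1 r, Node mu.2 r).
    rewrite [overlaps _ _]/= !mem_cat.
    by rewrite (map_f (fun mu => (Node mu.1 r, Node mu.2 r))) ?orbT.
  have [_ /step_arity mu_ar] := overlaps_step muP.
  exists (qs ++ cut r t2); cbn [fst snd]; rewrite size_cat size_qs size_cut //.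
  by split=> //; rewrite graft_all_Node_cat -?mu_ar // graft_all_cut.
case=> [_|l r /andP[lt1 rt2]].
  by left; exists [:: Node t1 u] => //; apply/SeqStepHead/StepRight.
case: (IH _ rt2) => [[us usP ->]|[mu muP [qs [size_qs -> ->]]]].
  left; exists (cut l t1 ++ us); first exact: seq_step_catr.
  by rewrite graft_all_Node_cat ?graft_all_cut // size_cut.
right; exists (Node l mu.1, Node l mu.2).
  rewrite [overlaps _ _]/= !mem_cat.
  by rewrite (map_f (fun mu => (Node l mu.1, Node l mu.2))) ?orbT.
exists (cut l t1 ++ qs); cbn [fst snd]; rewrite size_cat size_qs size_cut //.
by split=> //; rewrite graft_all_Node_cat ?size_cut // graft_all_cut.
Qed.

Definition joinable (t u : tree) : Prop :=
  exists2 v, clos_refl_trans tree (step R) t v & clos_refl_trans tree (step R) u v.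

Lemma joinable_sym t u : joinable t u -> joinable u t.
Proof. by case=> v; exists v. Qed.

Lemma steps_map (f : tree -> tree) :
    (forall t u, step R t u -> step R (f t) (f u)) ->
  forall t u, clos_refl_trans tree (step R) t u ->
    clos_refl_trans tree (step R) (f t) (f u).
Proof.
move=> fP t u; elim=> [x y xy|x|x y z _ xy _ yz].
- exact/rt_step/fP.
- exact: rt_refl.
exact: rt_trans xy yz.
Qed.

Lemma joinable_map (f : tree -> tree) t u :
    (forall t u, step R t u -> step R (f t) (f u)) ->
  joinable t u -> joinable (f t) (f u).
Proof. by move=> fP [v tv uv]; exists (f v); apply: steps_map. Qed.

Hypothesis overlapsR : {in R, forall rho, {in overlaps R rho.1,
  forall mu, joinable (contract rho mu.1) mu.2}}.

Lemma root_joinable rho t u : rho \in R -> tprefix rho.1 t -> step R t u ->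
  joinable (contract rho t) u.
Proof.
move=> rhoR rho_t tu.
case: (step_prefixP rho_t tu) => [[us usP ->]|[mu muP [qs [_ -> ->]]]].
  have size_us : size us = arity rho.1 by rewrite -(seq_step_size usP) size_cut.
  (* The redex of the other step lies below [rho.1]: the two contractions commute, each side closing
     in one step. *)
  exists (graft_all rho.2 us); apply: rt_step.
    by apply: seq_step_graft_all usP; rewrite size_cut ?arityR.
  rewrite -[in graft_all rho.2 us](cut_graft_all size_us).
  exact/StepRoot/tprefix_graft_all.
rewrite contract_graft_all //; last by case: (overlaps_step muP).
apply: (joinable_map (f := graft_all^~ qs)) => [? ?|]; first exact: step_subst.
exact: overlapsR.
Qed.

Lemma step_joinable t u v : step R t u -> step R t v -> joinable u v.
Proof.
move=> tu; elim: t u / tu v => [rho t rhoR rho_t|l l' r ll' IH|l r r' rr' IH] v tv.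
- exact: root_joinable.
- move E: (Node l r) tv => t tv.
  case: t v / tv E => [rho t rhoR rho_t|? l2 r2 tv|? ? r2 tv] E.
  + by rewrite -{}E in rho_t *; apply/joinable_sym/root_joinable/StepLeft.
  + case: E tv => <- <- /IH; apply: (joinable_map (f := Node^~ r)) => *.
    exact: StepLeft.
  (* Steps in different subtrees commute. *)
  case: E tv => <- <- rr2; exists (Node l' r2); apply: rt_step.
    exact: StepRight.
  exact: StepLeft.
move E: (Node l r) tv => t tv.
case: t v / tv E => [rho t rhoR rho_t|? l2 r2 tv|? ? r2 tv] E.
+ by rewrite -{}E in rho_t *; apply/joinable_sym/root_joinable/StepRight.
+ case: E tv => <- <- ll2; exists (Node l2 r'); apply: rt_step.
    exact: StepLeft.
  exact: StepRight.
case: E tv => <- <- /IH; apply: (joinable_map (f := Node l)) => *.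
exact: StepRight.
Qed.

End ArityPreserving.

(** * Abstract rewriting with a rank *)

(** Induction on [rank t]: the first steps of the two chains meet in [w]; the hypothesis at [t1]
    joins [u] and [w] in [x], then the one at [t2] joins [x] and [v]. *)
Lemma newman (T : Type) (R : relation T) (rank : T -> nat) :
    (forall t u, R t u -> rank u < rank t) ->
    (forall t u v, R t u -> R t v ->
       exists2 w, clos_refl_trans T R u w & clos_refl_trans T R v w) ->
  confluent R.
Proof.
move=> R_rank R_local t; have [n] := ubnP (rank t); elim: n t => // n IH t.
rewrite ltnS => t_n u v tu tv.
have {}tu := clos_rt_rt1n _ _ _ _ tu; have {}tv := clos_rt_rt1n _ _ _ _ tv.
case: u / tu => [|t1 u tt1 t1u].
  by exists v; [apply: clos_rt1n_rt | apply: rt_refl].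
have {}t1u := clos_rt1n_rt _ _ _ _ t1u.
case: v / tv => [|t2 v tt2 t2v].
  by exists u; [apply: rt_refl | apply: rt_trans t1u; apply: rt_step].
have {}t2v := clos_rt1n_rt _ _ _ _ t2v.
have [w t1w t2w] := R_local _ _ _ tt1 tt2.
have [x ux wx] := IH t1 (leq_trans (R_rank _ _ tt1) t_n) _ _ t1u t1w.
have t2x : clos_refl_trans T R t2 x by apply: rt_trans t2w wx.
have [y xy vy] := IH t2 (leq_trans (R_rank _ _ tt2) t_n) _ _ t2x t2v.
by exists y => //; apply: rt_trans ux xy.
Qed.

Lemma rank_terminating (T : Type) (R : relation T) (rank : T -> nat) :
  (forall t u, R t u -> rank u < rank t) -> terminating R.
Proof.
move=> R_rank [u uP].
have rank_u k : rank (u k) + k <= rank (u 0).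
  elim: k => [|k IH]; first by rewrite addn0.
  by apply: leq_trans IH; rewrite addnS -addSn leq_add2r R_rank.
by have := rank_u (rank (u 0)).+1; rewrite leqNgt addnS ltnS leq_addl.
Qed.

(** * Termination *)

Fixpoint word_value (w : seq nat) : nat :=
  if w is a :: w' then a * 2 ^ size w' + word_value w' else 0.

(** Lexicographic order where the first difference must be a [0] against a [2], so that it survives
    any change of the suffixes. *)
Definition word_lt (w w' : seq nat) : Prop :=
  exists u v v', w = u ++ 0 :: v /\ w' = u ++ 2 :: v'.

Lemma word_lt_cat u w w' : word_lt w w' -> word_lt (u ++ w) (u ++ w').
Proof. by case=> u' [v [v' [-> ->]]]; exists (u ++ u'), v, v'; rewrite !catA. Qed.

Lemma word_lt_cons a w w' : word_lt w w' -> word_lt (a :: w) (a :: w').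
Proof. exact: (word_lt_cat [:: a]). Qed.

Lemma word_value_lt w w' : {in w, forall a, a <= 2} -> size w = size w' ->
  word_lt w w' -> word_value w < word_value w'.
Proof.
(* In base 2 with digits up to 2, a tail still weighs less than a letter 2 placed before it. *)
have bound v : {in v, forall a, a <= 2} -> word_value v < 2 * 2 ^ size v.
  elim: v => //= a v IH av.
  have a2 : a <= 2 by apply: av; apply: mem_head.
  have {}IH : word_value v < 2 * 2 ^ size v.
    by apply: IH => b bv; apply: av; rewrite inE bv orbT.
  by rewrite expnS; nia.
move=> w2 size_w [u [v [v' [Ew Ew']]]]; move: w2 size_w; rewrite {}Ew {}Ew'.
elim: u => [|a u IH] /= w2 [size_w].
  rewrite mul0n add0n -size_w; apply: leq_trans (leq_addr _ _).
  by apply: bound => b bv; apply: w2; rewrite inE bv orbT.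
rewrite size_w ltn_add2l IH // => b bv.
by apply: w2; rewrite inE bv orbT.
Qed.

(* The lexicographic order on prefix words, read off the trees. *)
Fixpoint tree_lt (s t : tree) : bool :=
  match s, t with
  | Leaf, Node _ _ => true
  | Node l r, Node l' r' => tree_lt l l' || (l == l') && tree_lt r r'
  | _, _ => false
  end.

(** If the word of [t] starts with exactly [m] letters 2, its next letter 0 faces a 2, since the
    other word starts with [m + k.+1] of them. *)
Lemma word_lt_nseq t k v v' :
  word_lt (prefix_word t ++ v) (nseq k.+1 2 ++ prefix_word t ++ v').
Proof.
have two_comm w : nseq k 2 ++ 2 :: w = nseq k.+1 2 ++ w by elim: k => //= k ->.
elim: t v v' => [|l IHl r IHr] v v'.
  by exists [::], v, (nseq k 2 ++ 0 :: v').
by rewrite /=; apply: word_lt_cons; rewrite -!catA two_comm; apply: IHl.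
Qed.

(** Here [k] is the length of the leftmost branch of [t]. *)
Lemma prefix_word_graft_all t rs : exists k w,
  prefix_word (graft_all t rs) = nseq k 2 ++ prefix_word (head Leaf rs) ++ w.
Proof.
elim: t rs => [|l IHl r _] rs; first by exists 0, [::]; rewrite cats0.
have [k [w wP]] := IHl rs; rewrite graft_all_Node /= wP.
by exists k.+1; eexists; rewrite /= -!catA.
Qed.

(* A leaf [j] of [s] facing a node of [t] is replaced by [r_j], whose prefix word
   compares below the one of that node, which is [2^k r_j ...] with [k > 0]. *)
Lemma tree_lt_graft_all s t rs v v' : tree_lt s t ->
  word_lt (prefix_word (graft_all s rs) ++ v) (prefix_word (graft_all t rs) ++ v').
Proof.
elim: s t rs v v' => [|l IHl r IHr] [|l' r'] rs v v' //.
  move=> _; have [k [w wP]] := prefix_word_graft_all l' rs.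
  rewrite graft_all_Node [prefix_word (Node _ _)]/= wP cat_cons -!catA.
  exact: (word_lt_nseq _ k).
rewrite !graft_all_Node /= => lt; apply: word_lt_cons; rewrite -!catA.
case/orP: lt => [ll'|/andP[/eqP-> rr']]; first exact: IHl.
exact/word_lt_cat/IHr.
Qed.

Definition rank t := word_value (prefix_word t).

Lemma step_rank R t u :
    {in R, forall rho, arity rho.1 = arity rho.2} ->
    {in R, forall rho, tree_lt rho.2 rho.1} ->
  step R t u -> rank u < rank t.
Proof.
move=> arityR ltR tu; have letters s : {in prefix_word s, forall a, a <= 2}.
  elim: s => [|l IHl r IHr] a /=; rewrite inE ?mem_cat; first by move/eqP->.
  by case/or3P=> [/eqP->||] //; [apply: IHl | apply: IHr].
apply: word_value_lt => //.
  (* A tree with [n] leaves has a word of [2n - 1] letters, so steps preserve length. *)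
  have size_word s : (size (prefix_word s)).+1 = (arity s).*2.
    by elim: s => //= l IHl r IHr; rewrite size_cat doubleD -IHl -IHr addSn addnS.
  by apply: succn_inj; rewrite !size_word (step_arity arityR tu).
(* Arbitrary suffixes make the induction go through when a right subtree follows. *)
suff lt_cat v v' : word_lt (prefix_word u ++ v) (prefix_word t ++ v').
  by have := lt_cat [::] [::]; rewrite !cats0.
elim: tu v v' => [rho {}t rhoR rho_t|l l' r _ IH|l r r' _ IH] v v'.
- rewrite -[t in X in word_lt _ X](graft_all_cut rho_t).
  exact/tree_lt_graft_all/ltR.
- by rewrite /=; apply: word_lt_cons; rewrite -!catA; apply: IH.
by rewrite /=; apply: word_lt_cons; rewrite -!catA; apply/word_lt_cat/IH.
Qed.

(** * Operad congruences *)

Lemma step_graft R t i s s' : 0 < i <= arity t -> step R s s' ->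
  step R (graft t i s) (graft t i s').
Proof.
elim: t i => [|l IHl r IHr] i // /andP[i_gt0 i_le] ss' /=.
case: leqP => il; first by apply/StepLeft/IHl; rewrite ?i_gt0.
by apply/StepRight/IHr; rewrite // subn_gt0 il leq_subLR.
Qed.

Lemma rewrite_stepP (Q : relation tree) R :
    {in R, forall rho, arity rho.1 = arity rho.2} ->
    (forall s s', Q s s' <-> (s, s') \in R) ->
  forall t u, rewrite_step Q t u <-> step R t u.
Proof.
move=> arityR QR t u; split=> [[{}t i s s' rs iP size_rs /QR ss']|].
  apply: step_graft => //; rewrite -[in graft_all s' rs](cut_graft_all size_rs).
  exact: (StepRoot ss' (tprefix_graft_all _ _)).
elim=> {t u} [[s s'] t ssR s_t|l l' r _ [t i s s' rs iP size_rs ss']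
             |l r r' _ [t i s s' rs iP size_rs ss']].
- rewrite -[t in rewrite_step _ t](graft_all_cut s_t).
  by apply: (@RewriteStep _ Leaf 1) => //; [apply: size_cut | apply/QR].
- case/andP: (iP) => i_gt0 i_le; have := @RewriteStep Q (Node t r) i s s' rs.
  by rewrite /= i_le; apply=> //; rewrite i_gt0 (leq_trans i_le) ?leq_addr.
case/andP: iP => i_gt0 i_le.
(* The leaves of the right subtree are numbered after those of [l]. *)
have := @RewriteStep Q (Node l t) (arity l + i) s s' rs.
rewrite /=; have -> : (arity l + i <= arity l) = false by lia.
rewrite addKn; apply=> //.
by rewrite leq_add2l i_le addn_gt0 i_gt0 orbT.
Qed.

(* Subtrees missing at the end of the second argument of [graft_all] are read as
   leaves. *)
Lemma graft_graft_all t i s : 0 < i <= arity t ->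
  graft t i s = graft_all t (rcons (nseq i.-1 Leaf) s).
Proof.
elim: t i => [|l IHl r IHr] i; first by case: i => [|[]].
rewrite graft_all_Node [arity _]/= [graft _ _ _]/= => iP; case: leqP => il.
  rewrite IHl ?il ?andbT; last by lia.
  rewrite drop_oversize; last by rewrite size_rcons size_nseq; lia.
  by rewrite (@graft_all_Leaf r [::]).
have [k iE] : exists k, i = arity l + k.+1 by exists (i - arity l).-1; lia.
rewrite IHr iE; last by lia.
rewrite addKn addnS /= nseqD rcons_cat drop_size_cat ?size_nseq //.
by rewrite graft_all_cat ?size_nseq // (@graft_all_Leaf l) // => x /nseqP[].
Qed.

(** Complete composition as iterated partial compositions, to which [congr_graft] applies. *)
Fixpoint graft_from (t : tree) (j : nat) (rs : seq tree) : tree :=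
  if rs is r :: rs' then graft (graft_from t j.+1 rs') j r else t.

Lemma leq_arity_graft t i s : arity t <= arity (graft t i s).
Proof.
elim: t i => [|l IHl r IHr] i /=; first exact: arity_gt0.
by case: ifP => _ /=; rewrite ?leq_add2r ?leq_add2l.
Qed.

Lemma leq_arity_graft_from t j rs : arity t <= arity (graft_from t j rs).
Proof.
by elim: rs j => //= r rs IH j; apply: leq_trans (IH _) (leq_arity_graft _ _ _).
Qed.

Lemma graft_from_right l r j rs :
  graft_from (Node l r) (arity l + j.+1) rs = Node l (graft_from r j.+1 rs).
Proof.
elim: rs j => //= s rs IH j; rewrite -addnS IH /= addKn.
by have -> : (arity l + j.+1 <= arity l) = false by lia.
Qed.

Lemma graft_from_cat l r j rs qs : j + size rs = (arity l).+1 ->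
  graft_from (Node l r) j (rs ++ qs) =
  Node (graft_from l j rs) (graft_from r 1 qs).
Proof.
elim: rs j => [|s rs IH] j /=.
  by rewrite addn0 -addn1 => ->; apply: graft_from_right.
rewrite -addSnnS => jP; rewrite IH //=.
(* Leaf [j] is still in the left subtree, whose arity the earlier grafts cannot lower. *)
have := leq_arity_graft_from l j.+1 rs; case: (leqP j) => // *; exfalso; lia.
Qed.

(* Grafting on the last leaves first keeps the numbers of the earlier ones. *)
Lemma graft_from_graft_all s rs : size rs = arity s ->
  graft_from s 1 rs = graft_all s rs.
Proof.
elim: s rs => [|l IHl r IHr] rs; first by case: rs => [|a []].
move=> /size_split[rs1 [rs2 [-> size1 size2]]].
by rewrite graft_from_cat ?size1 // graft_all_Node_cat // IHl // IHr.
Qed.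

Section Congruence.

Variable E : relation tree.
Hypothesis E_congr : operad_congruence E.

Lemma congr_refl t : E t t.
Proof. by case: (congr_equiv E_congr). Qed.

Lemma congr_Node l l' r r' : E l l' -> E r r' -> E (Node l r) (Node l' r').
Proof.
(* Starting from the two-leaf tree, [r] is grafted on leaf 2 and then [l] on leaf 1. *)
move=> ll' rr'; apply: (congr_graft E_congr (i := 1) (t := Node Leaf r)
  (t' := Node Leaf r')) ll' => //.
exact: (congr_graft E_congr (i := 2) (t := Node Leaf Leaf) _ (congr_refl _)).
Qed.

Lemma congr_graft_from s s' j rs : E s s' -> j + size rs = arity s ->
  E (graft_from s j.+1 rs) (graft_from s' j.+1 rs).
Proof.
move=> ss'; elim: rs j => //= r rs IH j; rewrite -addSnnS => jP.
apply: (congr_graft E_congr) (IH _ jP) (congr_refl _).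
by apply: leq_trans (leq_arity_graft_from _ _ _); rewrite -jP addSn ltnS leq_addr.
Qed.

(** Contexts are handled by [congr_Node], substitutions by iterated grafting. *)
Lemma congr_step R : {in R, forall rho, E rho.1 rho.2} ->
  forall t u, step R t u -> E t u.
Proof.
move=> ER t u; elim=> [rho {}t rhoR rho_t|l l' r _ ?|l r r' _ ?].
- rewrite -[t in E t](graft_all_cut rho_t) /contract -!graft_from_graft_all.
  + by apply: congr_graft_from; [apply: ER | rewrite size_cut].
  + by rewrite size_cut // (congr_arity E_congr (ER _ rhoR)).
  by rewrite size_cut.
- exact/congr_Node/congr_refl.
exact: congr_Node (congr_refl _) _.
Qed.

End Congruence.

Lemma clos_rst_congruence R : {in R, forall rho, arity rho.1 = arity rho.2} ->
  operad_congruence (clos_refl_sym_trans tree (step R)).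
Proof.
move=> arityR.
have arityE t t' : clos_refl_sym_trans tree (step R) t t' -> arity t = arity t'.
  by elim=> [x y /step_arity-> //|//|x y _ ->//|x y z _ -> _ ->].
split=> // [|t t' s s' i iP tt' ss']; first exact: clos_rst_is_equiv.
(* The outer tree changes first, by stability under substitution; then the grafted tree, by
   stability under contexts. *)
apply: (rst_trans _ _ _ (graft t' i s)).
  elim: tt' iP => [x y xy|x|x y xy IH|x y z xy IHxy yz IHyz] iP.
  - rewrite !graft_graft_all -?(step_arity arityR xy) //.
    exact/rst_step/step_subst.
  - exact: rst_refl.
  - by apply/rst_sym/IH; rewrite (arityE _ _ xy).
  by apply: rst_trans (IHxy iP) (IHyz _); rewrite -(arityE _ _ xy).
rewrite (arityE _ _ tt') in iP.
elim: ss' => [x y xy|x|x y xy IH|x y z xy IHxy yz IHyz].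
- exact/rst_step/step_graft.
- exact: rst_refl.
- exact: rst_sym.
exact: rst_trans IHxy IHyz.
Qed.

(** * The eleven rules *)

(** The result is the stack of trees spelled by the suffix; a letter 2 joins the top two. *)
Fixpoint parse (w : seq nat) : seq tree :=
  match w with
  | [::] => [::]
  | 0 :: w' => Leaf :: parse w'
  | _ :: w' => if parse w' is l :: r :: ts then Node l r :: ts else [::]
  end.

Definition tree_of_word w := head Leaf (parse w).

Lemma prefix_wordK : cancel prefix_word tree_of_word.
Proof.
have parse_cat t w : parse (prefix_word t ++ w) = t :: parse w.
  by elim: t w => //= l IHl r IHr w; rewrite -catA IHl IHr.
by move=> t; rewrite /tree_of_word -[prefix_word t]cats0 parse_cat.
Qed.

Definition CAs3_rules : seq (tree * tree) :=
  [seq (tree_of_word w.1, tree_of_word w.2) | w <- CAs3_rule_words].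

Lemma CAs3_ruleP s s' : CAs3_rule s s' <-> (s, s') \in CAs3_rules.
Proof.
split=> [/(map_f (fun w => (tree_of_word w.1, tree_of_word w.2)))|/mapP[w wP]].
  by rewrite /= !prefix_wordK.
have words_ok : all (fun w => w == (prefix_word (tree_of_word w.1),
    prefix_word (tree_of_word w.2))) CAs3_rule_words by vm_compute.
by case=> -> ->; rewrite /CAs3_rule -(eqP (allP words_ok w wP)).
Qed.

Lemma CAs3_arity : {in CAs3_rules, forall rho, arity rho.1 = arity rho.2}.
Proof.
have arity_ok : all (fun rho => arity rho.1 == arity rho.2) CAs3_rules.
  by vm_compute.
by move=> rho /(allP arity_ok)/eqP.
Qed.

Lemma CAs3_tree_lt : {in CAs3_rules, forall rho, tree_lt rho.2 rho.1}.
Proof. by apply/allP; vm_compute. Qed.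

Lemma CAs3_overlaps : {in CAs3_rules, forall rho, {in overlaps CAs3_rules rho.1,
  forall mu, joinable CAs3_rules (contract rho mu.1) mu.2}}.
Proof.
(* The longest normalization takes 16 steps. *)
have nf_eq : all (fun rho => all (fun mu =>
    normalize CAs3_rules 16 (contract rho mu.1) == normalize CAs3_rules 16 mu.2)
    (overlaps CAs3_rules rho.1)) CAs3_rules by vm_compute.
move=> rho /(allP nf_eq)/allP mu_nf mu /mu_nf/eqP nf_mu.
exists (normalize CAs3_rules 16 mu.2); last exact: normalize_steps.
by rewrite -nf_mu; apply: normalize_steps.
Qed.

(** Both orientations, so that steps walk the undirected graph generating the congruence. *)
Definition comb_rules := [:: (LComb 3, RComb 3); (RComb 3, LComb 3)].

Definition comb_ball n t :=
  iter n (fun A => undup (A ++ flatten [seq reducts comb_rules a | a <- A])) [:: t].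

Lemma comb_ball_congruence n t u : u \in comb_ball n t -> comb_congruence 3 t u.
Proof.
move=> + E E_congr E_comb.
have [Erefl Etrans Esym] := congr_equiv E_congr.
have E_rules : {in comb_rules, forall rho, E rho.1 rho.2}.
  by move=> rho; rewrite !inE => /orP[]/eqP-> //; apply: Esym.
elim: n u => [|n IH] u /=; first by rewrite inE => /eqP->.
rewrite mem_undup mem_cat => /orP[/IH//|/flatten_mapP[a /IH ta au]].
exact/(Etrans _ _ _ ta)/(congr_step E_congr E_rules)/reducts_step.
Qed.

Lemma CAs3_rules_congruence :
  {in CAs3_rules, forall rho, comb_congruence 3 rho.1 rho.2}.
Proof.
(* The two members of each rule are at distance at most 20 in the graph of the
   replacements of [LComb 3] by [RComb 3] and conversely. *)
have meet : all (fun rho => let ball := comb_ball 10 rho.1 in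
    has [in ball] (comb_ball 10 rho.2)) CAs3_rules by vm_compute.
move=> rho /(allP meet)/hasP[u /comb_ball_congruence u2 /comb_ball_congruence u1].
move=> E E_congr E_comb; have [_ Etrans Esym] := congr_equiv E_congr.
exact: Etrans (u1 E E_congr E_comb) (Esym _ _ (u2 E E_congr E_comb)).
Qed.

Theorem theorem3p3p1 :
  convergent (rewrite_step CAs3_rule) /\
  (forall t t' : tree,
     clos_refl_sym_trans tree (rewrite_step CAs3_rule) t t' <->
     comb_congruence 3 t t').
Proof.
have stepP := rewrite_stepP CAs3_arity CAs3_ruleP.
have rankP t u : rewrite_step CAs3_rule t u -> rank u < rank t.
  by move/stepP; apply: step_rank CAs3_arity CAs3_tree_lt.
split; first split; first exact: rank_terminating rankP.
  apply: (newman rankP) => t u v /stepP tu /stepP tv.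
  have rt_step_rewrite x y : clos_refl_trans tree (step CAs3_rules) x y ->
      clos_refl_trans tree (rewrite_step CAs3_rule) x y.
    elim=> [a b /stepP|a|a b c _ ab _ bc]; [exact: rt_step|exact: rt_refl|].
    exact: rt_trans ab bc.
  have [w uw vw] := step_joinable CAs3_arity CAs3_overlaps tu tv.
  by exists w; apply: rt_step_rewrite.
move=> t t'; split=> [tt' E E_congr E_comb | comb_tt'].
  have [Erefl Etrans Esym] := congr_equiv E_congr.
  elim: tt' => [x y /stepP|x|x y _|x y z _ xy _ yz].
  - by apply: (congr_step E_congr) => rho /CAs3_rules_congruence; apply.
  - exact: Erefl.
  - exact: Esym.
  exact: Etrans xy yz.
(* The closure is itself a congruence relating the two combs, so it contains the smallest one. *)
have comb_rst : clos_refl_sym_trans tree (step CAs3_rules) (LComb 3) (RComb 3).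
  by apply/rst_step/reducts_step; vm_compute.
elim: (comb_tt' _ (clos_rst_congruence CAs3_arity) comb_rst).
- by move=> x y /stepP; apply: rst_step.
- exact: rst_refl.
- by move=> x y _; apply: rst_sym.
by move=> x y z _ xy _ yz; apply: rst_trans xy yz.
Qed.
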